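(* Let $B\subset[a,b]$ be symmetrically porous and let $h:[a,b]\to\mathbb{R}$ be continuously differentiable and bilipschitz. Then $h(B)$ is symmetrically porous.
   Context: Bilipschitz means there is $L>0$ with $L^{-1}|x-y|\le|h(x)-h(y)|\le L|x-y|$ for all $x,y\in[a,b]$. Symmetric porosity: for $M\subset\mathbb{R}$, $x\in M$, $R>0$, let $S\gamma(x,R,M)$ be the supremum of all $r>0$ for which there exists $z\in\mathbb{R}$ with $B(z,r)\cup B(2x-z,r)\subset B(x,R)\setminus M$, where $B(z,r)=(z-r,z+r)$ (the supremum is $0$ if there is no such $r$). The symmetric upper porosity of $M$ at $x$ is $S\overline{p}(M,x)=2\limsup_{R\to0+}S\gamma(x,R,M)/R$. The set $M$ is symmetrically porous if $S\overline{p}(M,x)>0$ for all $x\in M$. *)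

(* Defs.v *)
From mathcomp Require Import all_boot all_order all_algebra.
From mathcomp Require Import all_classical all_reals all_analysis.
Set Implicit Arguments.
Unset Strict Implicit.
Unset Printing Implicit Defensive.
Import Order.TTheory GRing.Theory Num.Theory.
Import numFieldNormedType.Exports.
Local Open Scope classical_set_scope.
Local Open Scope ring_scope.

(* The set of admissible radii is bounded by rho, and [sup set0 = 0]. *)
Definition Sgamma (R : realType) (x rho : R) (M : set R) : R :=
  sup [set r | 0 < r /\
    exists z : R, ball z r `|` ball (2 * x - z) r `<=` ball x rho `\` M].

Definition sym_upper_porosity (R : realType) (M : set R) (x : R) : \bar R :=
  (2%:E * limf_esup (fun rho : R => (Sgamma x rho M / rho)%:E) (0 : R)^'+)%E.

Definition sym_porous (R : realType) (M : set R) : Prop :=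
  forall x, M x -> (0 < sym_upper_porosity M x)%E.

(* The derivative is relative to A: when A = `[a, b] it is one-sided at the
   endpoints, and the values of f outside A play no role. *)
Definition continuously_differentiable_on (R : realType) (A : set R)
    (f : R -> R) : Prop :=
  exists df : R -> R,
    (forall x, A x ->
      (f y - f x) / (y - x) @[y --> within A x^'] --> df x) /\
    {within A, continuous df}.

Definition bilipschitz_on (R : realType) (A : set R) (f : R -> R) : Prop :=
  exists L : R, 0 < L /\
    forall x y, A x -> A y ->
      L^-1 * `|x - y| <= `|f x - f y| <= L * `|x - y|.

(* Main.v *)
Require Import Defs.
From mathcomp Require Import all_boot all_order all_algebra.
From mathcomp Require Import all_classical all_reals all_analysis.
From mathcomp Require Import ring lra.
Set Implicit Arguments.
Unset Strict Implicit.
Unset Printing Implicit Defensive.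
Import Order.TTheory GRing.Theory Num.Theory.
Import numFieldNormedType.Exports.
Local Open Scope classical_set_scope.
Local Open Scope ring_scope.

(** Symmetric porosity of [B] at [x] yields, at arbitrarily small scales [rho],
    two gaps [B(x + s, r)], [B(x - s, r)] of [B] with [r > c * rho].  Let [m] be
    the derivative of [h] at [x], which the lower Lipschitz bound forces to be
    nonzero.  By that same bound, a point [y] of [B] whose image is at distance
    O(rho) from [h x] is itself at distance O(rho) from [x], so the first order
    error [h y - h x - m * (y - x)] is o(rho).  Hence the intervals of radius
    [`|m| * r / 2] around [h x + m * s] and [h x - m * s], which are symmetric
    about [h x], contain no point of [h(B)] once [rho] is small. *)

Lemma ball_sub_lt (R : realType) (x z r rho : R) : 0 < r ->
  ball z r `<=` ball x rho -> `|z - x| < rho /\ r < 2 * rho.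
Proof.
move=> r0 sub; split; first by rewrite distrC; apply: sub; exact: ballxx.
have : `|x - (z + r / 2)| < rho.
  by apply: sub; rewrite /ball /= ltr_norml; apply/andP; split; lra.
have : `|x - (z - r / 2)| < rho.
  by apply: sub; rewrite /ball /= ltr_norml; apply/andP; split; lra.
rewrite !ltr_norml => /andP[? ?] /andP[? ?]; lra.
Qed.

(** Anything strictly below a supremum is exceeded by an element, so the limsup over scales and the
    sup over radii unfold into witnesses. Conversely, one admissible radius bounds the sup from
    below. *)
Lemma sym_upper_porosity_gt0P (R : realType) (M : set R) (x : R) :
  (0 < sym_upper_porosity M x)%E <->
  exists2 c : R, 0 < c & forall e : R, 0 < e ->
    exists rho r z : R, [/\ 0 < rho < e, c * rho < r &
      ball z r `|` ball (2 * x - z) r `<=` ball x rho `\` M].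
Proof.
rewrite /sym_upper_porosity pmule_rgt0 ?lte_fin// limf_esupE; split.
  move=> limsup_gt0.
  have [c c0 c_lt] : exists2 c : R, 0 < c & (c%:E < ereal_inf
      [set ereal_sup [set (Sgamma x rho M / rho)%:E | rho in V]
        | V in (0 : R)^'+])%E.
    move: limsup_gt0; case: ereal_inf => [u| |]//.
    - by rewrite lte_fin => u0; exists (u / 2); rewrite ?lte_fin; lra.
    - by exists 1; rewrite ?ltry.
  exists c => // e e0.
  have /(lt_le_trans c_lt) : (ereal_inf
      [set ereal_sup [set (Sgamma x rho M / rho)%:E | rho in V]
        | V in (0 : R)^'+] <=
      ereal_sup [set (Sgamma x rho M / rho)%:E | rho in `]0%R, e[%classic])%E.
    apply: ereal_inf_lbound; exists `]0, e[%classic => //.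
    exists e => //= t /=; rewrite sub0r normrN in_itv /= => te t0.
    by rewrite t0 (le_lt_trans (ler_norm t)).
  move=> /ereal_sup_gtP[_ [rho /= /[!in_itv]/= rho0e <-]].
  have rho0 : 0 < rho by case/andP: rho0e.
  rewrite lte_fin ltr_pdivlMr// => c_sup.
  have [r [_ [z zr]] cr] : exists2 r, [set r | 0 < r /\ exists z : R,
      ball z r `|` ball (2 * x - z) r `<=` ball x rho `\` M] r & c * rho < r.
    (* With no admissible radius the sup would be [0], which is below [c * rho]. *)
    apply: sup_gt (c_sup); apply/set0P/eqP => E.
    by move: c_sup; rewrite /Sgamma E sup0 ltNge ltW// mulr_gt0.
  by exists rho, r, z.
move=> [c c0 hc]; apply: (@lt_le_trans _ _ c%:E); rewrite ?lte_fin//.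
apply: le_ereal_inf_tmp => _ [V [e /= e0 eV] <-].
have [rho [r [z [/andP[rho0 rhoe] cr zr]]]] := hc e e0.
have r0 : 0 < r by rewrite (lt_trans _ cr)// mulr_gt0.
apply: (@le_trans _ _ (Sgamma x rho M / rho)%:E); last first.
  apply: ereal_sup_ubound; exists rho => //; apply: eV => //=.
  by rewrite sub0r normrN gtr0_norm.
rewrite lee_fin ler_pdivlMr// (le_trans (ltW cr))//.
apply: ub_le_sup; last by split=> //; exists z.
(* The sup dominates its elements only once the set of radii is known to be bounded. *)
exists (2 * rho) => t [t0 [w wt]]; apply/ltW.
have [|//] := @ball_sub_lt _ x w t rho t0.
by move=> y wy; case: (wt y (or_introl wy)).
Qed.

(** Both estimates on [h] concern points of [B] only, so endpoints of the interval and the case of a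
    single point are covered too. *)
Lemma sym_upper_porosity_image (R : realType) (B : set R) (h : R -> R)
    (x m l : R) :
  m != 0 -> 0 < l ->
  (forall y, B y -> l * `|y - x| <= `|h y - h x|) ->
  (forall e, 0 < e -> exists2 d, 0 < d & forall y, B y -> `|y - x| < d ->
     `|h y - h x - m * (y - x)| <= e * `|y - x|) ->
  (0 < sym_upper_porosity B x)%E -> (0 < sym_upper_porosity (h @` B) (h x))%E.
Proof.
move=> m_neq0 l0 hl hm /sym_upper_porosity_gt0P[c c0 hc].
have m0 : 0 < `|m| by rewrite normr_gt0.
(* The new radius is [|m| * r / 2] and the new scale [2 * |m| * rho]; their ratio exceeds
   [c / 4]. *)
apply/sym_upper_porosity_gt0P; exists (c / 4) => [|e e0]; first lra.
(* On [|y - x| < K * rho] this tolerance keeps the first order error below [|m| * c * rho / 2],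
   hence below [|m| * r / 2]. *)
have [d d0 hd] := hm (c * l / 4) ltac:(by rewrite divr_gt0 ?mulr_gt0).
pose K := 2 * `|m| / l.
have K0 : 0 < K by rewrite divr_gt0 ?mulr_gt0.
(* The first bound puts [K * rho] below [d], the second puts the new scale below [e]. *)
have [|rho [r [z [/andP[rho0]]]]] := hc (Num.min (d / K) (e / (2 * `|m|))).
  by rewrite lt_min !divr_gt0 ?mulr_gt0.
rewrite lt_min ltr_pdivlMr// ltr_pdivlMr ?mulr_gt0// => /andP[rhod rhoe] cr zr.
have r0 : 0 < r by rewrite (lt_trans _ cr)// mulr_gt0.
have [zx r2] : `|z - x| < rho /\ r < 2 * rho.
  by apply: ball_sub_lt => // y zy; case: (zr y (or_introl zy)).
have mr2 : `|m| * r / 2 < `|m| * rho.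
  by rewrite -mulrA ltr_pM2l//; lra.
have gap s : `|s| < rho -> (forall y, B y -> ~ ball (x + s) r y) ->
    ball (h x + m * s) (`|m| * r / 2) `<=`
    ball (h x) (2 * `|m| * rho) `\` (h @` B).
  move=> s_rho s_gap u; rewrite {1}/ball /= => us.
  have ux : `|h x - u| < 2 * `|m| * rho.
    have -> : h x - u = (h x + m * s - u) - m * s by ring.
    rewrite (le_lt_trans (ler_normB _ _))// normrM.
    have : `|m| * `|s| < `|m| * rho by rewrite ltr_pM2l.
    lra.
  split=> // -[y By hyu]; apply: (s_gap y By); move: us ux; rewrite -hyu.
  rewrite /ball /= => us ux.
  have yx : `|y - x| < K * rho.
    rewrite /K mulrAC ltr_pdivlMr// mulrC.
    by rewrite (le_lt_trans (hl y By))// distrC.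
  have yd : `|y - x| < d by rewrite (lt_trans yx)// mulrC.
  have err := hd y By yd.
  (* After scaling by [|m|], the distance splits into the distance of the images and the first order
     error, each below [|m| * r / 2]. *)
  rewrite -(ltr_pM2l m0) -normrM.
  have -> : m * (x + s - y) =
    (h x + m * s - h y) + (h y - h x - m * (y - x)) by ring.
  rewrite (le_lt_trans (ler_normD _ _))//.
  have : c * l / 4 * `|y - x| < c * l / 4 * (K * rho).
    by rewrite ltr_pM2l// divr_gt0 ?mulr_gt0.
  have -> : c * l / 4 * (K * rho) = `|m| * (c * rho) / 2.
    by rewrite /K; field; exact: lt0r_neq0.
  have : `|m| * (c * rho) < `|m| * r by rewrite ltr_pM2l.
  lra.
exists (2 * `|m| * rho), (`|m| * r / 2), (h x + m * (z - x)); split.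
- by rewrite !mulr_gt0//= mulrC.
- by have : `|m| * (c * rho) < `|m| * r; [rewrite ltr_pM2l | lra].
- have -> : 2 * h x - (h x + m * (z - x)) = h x + m * (x - z) by ring.
  move=> u [|].
  + apply: gap => // y By; rewrite addrC subrK => zy.
    by case: (zr y (or_introl zy)).
  + apply: gap; rewrite 1?distrC// => y By.
    have -> : x + (x - z) = 2 * x - z by ring.
    by move=> zy; case: (zr y (or_intror zy)).
Qed.

Lemma diff_quotient_cvg_taylor (R : realType) (A : set R) (h : R -> R)
    (x m : R) :
  (h y - h x) / (y - x) @[y --> within A x^'] --> m ->
  forall e, 0 < e -> exists2 d, 0 < d & forall y, A y -> `|y - x| < d ->
    `|h y - h x - m * (y - x)| <= e * `|y - x|.
Proof.
move=> /cvgrPdist_le hm e /hm[d /= d0 hd]; exists d => // y Ay yx.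
have [->|y_neq] := eqVneq y x; first by rewrite !subrr mulr0 subrr normr0 mulr0.
have yx0 : y - x != 0 by rewrite subr_eq0.
have -> : h y - h x - m * (y - x) = - (m - (h y - h x) / (y - x)) * (y - x).
  by field.
rewrite normrM normrN ler_wpM2r//; apply: hd => //=.
by rewrite distrC.
Qed.

(** Step to the right of [x], or to the left when [x = b]. Such a point is what refutes a zero
    derivative. *)
Lemma itv_near_point (R : realType) (a b x d : R) : a < b -> a <= x <= b ->
  0 < d -> exists y, [/\ a <= y <= b, y != x & `|y - x| < d].
Proof.
move=> ab /andP[ax xb] d0; have [xltb|blex] := ltP x b.
  exists (Num.min b (x + d / 2)).
  have [?|?] := leP b (x + d / 2).
    by split; [lra|rewrite gt_eqF|rewrite ltr_norml; lra].
  by split; [lra|rewrite gt_eqF//; lra|rewrite ltr_norml; lra].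
exists (Num.max a (x - d / 2)).
have [?|?] := leP a (x - d / 2).
  by split; [lra|rewrite lt_eqF//; lra|rewrite ltr_norml; lra].
by split; [lra|rewrite lt_eqF//; lra|rewrite ltr_norml; lra].
Qed.

Theorem lemma4p6 (R : realType) (a b : R) (B : set R) (h : R -> R)
    (B_sub : B `<=` `[a, b])
    (B_porous : sym_porous B)
    (h_C1 : continuously_differentiable_on `[a, b] h)
    (h_bilip : bilipschitz_on `[a, b] h) :
  sym_porous (h @` B).
Proof.
move=> _ [x Bx <-].
have [df [/(_ x (B_sub x Bx)) h_df _]] := h_C1.
have [L [L0 h_lip]] := h_bilip.
have xab : a <= x <= b by have := B_sub x Bx; rewrite /= in_itv.
have h_lower y : B y -> L^-1 * `|y - x| <= `|h y - h x|.
  by move=> By; case/andP: (h_lip y x (B_sub y By) (B_sub x Bx)).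
have taylor := diff_quotient_cvg_taylor h_df.
have [ab|ba] := ltP a b; last first.
  (* [a = b]: every slope is a derivative of [h] relative to a singleton. *)
  apply: (@sym_upper_porosity_image _ _ _ _ 1 L^-1); rewrite ?oner_neq0 ?invr_gt0//.
    move=> e e0; exists 1 => // y By _.
    have := B_sub y By; rewrite /= in_itv/= => yab.
    have -> : y = x by lra.
    by rewrite !subrr mulr0 subrr normr0 mulr0.
  exact: B_porous.
apply: (@sym_upper_porosity_image _ _ _ _ (df x) L^-1); rewrite ?invr_gt0//.
(* With derivative zero, [h] would vary by at most half of what the lower Lipschitz bound demands
   between [x] and a nearby [y]. *)
- apply/negP => /eqP df0.
  have [|d d0 hd] := taylor (L^-1 / 2); first by rewrite divr_gt0 ?invr_gt0.
  have [y [yab y_neq yx]] := itv_near_point ab xab d0.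
  have yI : `[a, b]%classic y by rewrite /= in_itv.
  have := hd y yI yx; rewrite df0 mul0r subr0.
  have /andP[+ _] := h_lip y x yI (B_sub x Bx).
  have : 0 < L^-1 * `|y - x| by rewrite mulr_gt0 ?invr_gt0// normr_gt0 subr_eq0.
  lra.
- move=> e /taylor[d d0 hd]; exists d => // y By.
  exact: hd (B_sub y By).
- exact: B_porous.
Qed.
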